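(* Let $G$ be a strongly amenable topological group and let $L$ be a closed subgroup of $G$ for which the canonical map $\pi:G\to X$, $\pi(y)=Ly$, is a fiber bundle, where $X=G/L$ is the right $G$-space of right cosets of $L$ in $G$. Let $E$ be a Banach space, let $\delta\ge 0$ be a real number, and suppose that $h:G\to E^*$ and $f:X\to E^*$ are continuous maps such that $$\|f(xy)-f(x)-h(y)\|\leq\delta\qquad\text{for all }x\in X,\ y\in G.$$ Then there exist continuous maps $H:G\to E^*$ and $F:X\to E^*$ such that for all $x\in X$ and $y,z\in G$: $$H(yz)=H(y)+H(z),\qquad F(xy)=F(x)+H(y),\qquad \|H(y)-h(y)\|\leq\delta,\qquad \|F(x)-f(x)\|\leq2\delta.$$
   Context: Banach spaces are over $\mathbb{R}$; $E^*$ is the dual Banach space of $E$ with its norm topology. Strong amenability: let $\mathbf{CB}(G)$ be the Banach space (sup norm) of bounded continuous real-valued functions on $G$. The topological group $G$ is strongly amenable if there is a left invariant mean on $\mathbf{CB}(G)$, i.e. a bounded linear functional $m:\mathbf{CB}(G)\to\mathbb{R}$ with $m(1)=\|m\|=1$ and $m(x\mapsto f(yx))=m(f)$ for all $f\in\mathbf{CB}(G)$, $y\in G$. (Equivalently, via inversion, there is a right invariant mean on $\mathbf{CB}(G)$, i.e. the same with $x\mapsto f(xy)$.) $G/L$ denotes the space of right cosets $Ly$ ($y\in G$) with the quotient topology coinduced by $\pi$, with right $G$-action $(Ly,y')\mapsto Lyy'$. A local cross section around a point $Ly\in G/L$ is a continuous map $s:U\to G$ from an open neighborhood $U$ of $Ly$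 in $G/L$ such that $\pi s=\mathrm{id}_U$. The map $\pi:G\to G/L$ is a fiber bundle if and only if the point $Le$ (and hence every point of $G/L$) has a local cross section around it. *)

(* Defs.v *)
From HB Require Import structures.
From mathcomp Require Import all_boot all_order all_algebra.
From mathcomp Require Import generic_quotient.
From mathcomp Require Import boolp classical_sets functions reals topology.
From mathcomp Require Import normedtype.

Set Implicit Arguments.
Unset Strict Implicit.
Unset Printing Implicit Defensive.

Import Order.TTheory GRing.Theory Num.Theory.
Import numFieldNormedType.Exports.

Local Open Scope classical_set_scope.
Local Open Scope ring_scope.
Local Open Scope quotient_scope.

HB.mixin Record isTopologicalGroup G of Topological G & Group G := {
  mulg_continuous : continuous (fun x : G * G => (x.1 * x.2)%g);
  invg_continuous : continuous (fun x : G => x^-1%g)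
}.

#[short(type="topologicalGroupType")]
HB.structure Definition TopologicalGroup :=
  {G of Topological G & Group G & isTopologicalGroup G}.

Section right_cosets.
Context {G : topologicalGroupType} (L : groupClosed G).

(* Lx = Ly if and only if y x^-1 is in L *)
Definition rcoset_rel : rel G := fun x y => (y / x)%g \in L.

Lemma rcoset_rel_refl : reflexive rcoset_rel.
Proof. by move=> x; rewrite /rcoset_rel mulgV gpred1. Qed.

Lemma rcoset_rel_sym : symmetric rcoset_rel.
Proof. by move=> x y; rewrite /rcoset_rel gpredFC. Qed.

Lemma rcoset_rel_trans : transitive rcoset_rel.
Proof.
move=> y x z; rewrite /rcoset_rel => yxL zyL.
by have := gpredM _ _ zyL yxL; rewrite mulgA mulgVK.
Qed.

Canonical rcoset_equiv :=
  EquivRel rcoset_rel rcoset_rel_refl rcoset_rel_sym rcoset_rel_trans.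

Definition rcoset_space : Type := quotient_topology {eq_quot rcoset_equiv}.

HB.instance Definition _ := Topological.on rcoset_space.
HB.instance Definition _ := Quotient.on rcoset_space.

Definition rcoset_pi (y : G) : rcoset_space := \pi_rcoset_space y.

(* (Lz) y = L(zy); independent of the representative by rcoset_act_pi *)
Definition rcoset_act (x : rcoset_space) (y : G) : rcoset_space :=
  rcoset_pi (repr x * y)%g.

Lemma rcoset_piE x y : (rcoset_pi x = rcoset_pi y) <-> (y / x)%g \in L.
Proof. by split=> [/eqmodP|?] //; apply/eqmodP. Qed.

Lemma rcoset_act_pi z y : rcoset_act (rcoset_pi z) y = rcoset_pi (z * y)%g.
Proof.
apply/rcoset_piE; rewrite invgM mulgA mulgK.
by apply/rcoset_piE; rewrite /rcoset_pi reprK.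
Qed.

End right_cosets.

(* phi and t |-> (p t, psi t) are mutually inverse homeomorphisms between U * F
   and p^-1(U), commuting with the projections to U. *)
Definition trivial_over {T B F : topologicalType} (p : T -> B) (U : set B) :=
  exists (phi : B * F -> T) (psi : T -> F),
    [/\ {within U `*` [set: F], continuous phi},
        {within p @^-1` U, continuous psi},
        forall b v, U b -> p (phi (b, v)) = b /\ psi (phi (b, v)) = v
      & forall t, U (p t) -> phi (p t, psi t) = t].

Definition fiber_bundle {T B : topologicalType} (p : T -> B) :=
  continuous p /\
  exists F : topologicalType,
    forall b : B, exists U, open_nbhs b U /\ trivial_over (F := F) p U.

(* s is total; only its values on U matter. *)
Definition local_cross_section {T B : topologicalType} (p : T -> B) (b : B) :=
  exists (U : set B) (s : B -> T),
    [/\ open_nbhs b U, {within U, continuous s} & forall u, U u -> p (s u) = u].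

Section rcoset_fiber_bundle.
Context {G : topologicalGroupType} (L : groupClosed G).
Local Notation pi := (rcoset_pi L).

Lemma pair_cvg (T U V : topologicalType) (u : T -> U) (v : T -> V) (t : T) :
  {for t, continuous u} -> {for t, continuous v} ->
  {for t, continuous (fun x => (u x, v x))}.
Proof. by move=> cu cv; exact: cvg_pair. Qed.

Lemma openXT (T U : topologicalType) (A : set T) :
  open A -> open (A `*` [set: U]).
Proof.
move=> oA; rewrite (_ : _ `*` _ = fst @^-1` A).
  by apply: open_comp => // x _; exact: cvg_fst.
by apply/seteqP; split => -[x y] //= [].
Qed.

Lemma mulg_cvg (T : topologicalType) (u v : T -> G) (t : T) :
  {for t, continuous u} -> {for t, continuous v} ->
  {for t, continuous (fun x => u x * v x)%g}.
Proof.
move=> cu cv.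
apply: (@continuous_comp _ _ _ (fun x => (u x, v x)) (fun z => z.1 * z.2)%g).
  exact: cvg_pair.
exact: mulg_continuous.
Qed.

Lemma invg_cvg (T : topologicalType) (u : T -> G) (t : T) :
  {for t, continuous u} -> {for t, continuous (fun x => (u x)^-1)%g}.
Proof. by move=> cu; apply: continuous_comp => //; exact: invg_continuous. Qed.

Lemma rcoset_pi_continuous : continuous pi.
Proof. exact: pi_continuous. Qed.

Lemma rcoset_pi_repr (x : rcoset_space L) : pi (repr x) = x.
Proof. exact: reprK. Qed.

Lemma rcoset_act_continuous (y : G) : continuous (fun x => @rcoset_act G L x y).
Proof.
apply/quotient_continuous.
rewrite (_ : _ \o _ = fun z => pi (z * y)%g); last first.
  by apply/funext => z; rewrite -rcoset_act_pi.
move=> z; apply: (@continuous_comp _ _ _ (fun z => z * y)%g).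
  by apply: mulg_cvg; [exact: cvg_id|exact: cst_continuous].
exact: rcoset_pi_continuous.
Qed.

Lemma rcoset_fiber_bundleP :
  fiber_bundle pi <-> local_cross_section pi (pi 1%g).
Proof.
split.
  move=> [_ [F /(_ (pi 1%g)) [U [Uo [phi [psi [cphi _ phiK _]]]]]]].
  exists U, (fun b => phi (b, psi 1%g)); split => //; last first.
    by move=> u Uu; have [] := phiK u (psi 1%g) Uu.
  have [oU _] := Uo; rewrite continuous_open_subspace// => b bU.
  apply: (@continuous_comp _ _ _ (fun b => (b, psi 1%g)) phi).
    by apply: (pair_cvg (u := id)); [exact: cvg_id|exact: cst_continuous].
  have oUT : open (U `*` [set: F]) by exact: openXT.
  rewrite continuous_open_subspace// in cphi.
  by apply: (cphi (b, psi 1%g)); rewrite inE; split => //=; exact: set_mem.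
move=> [U [s [[oU U1] cs sK]]]; split; first exact: rcoset_pi_continuous.
have {}cs : {in U, continuous s} by rewrite -continuous_open_subspace.
exists (set_type [set` L]) => b.
pose g := repr b.
pose V := (fun x => rcoset_act x g^-1%g) @^-1` U.
have oV : open V by move/continuousP : (@rcoset_act_continuous g^-1%g); exact.
pose sg x := (s (rcoset_act x g^-1) * g)%g.
have csg x : V x -> {for x, continuous sg}.
  move=> Vx; apply: mulg_cvg; last exact: cst_continuous.
  apply: (@continuous_comp _ _ _ (fun x => rcoset_act x g^-1%g) s).
    exact: rcoset_act_continuous.
  by apply: cs; rewrite inE.
have sgK x : V x -> pi (sg x) = x.
  move=> Vx; rewrite /sg -rcoset_act_pi sK//.
  by rewrite -[x in LHS]rcoset_pi_repr !rcoset_act_pi mulgVK rcoset_pi_repr.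
have L1 : 1%g \in [set` L] by rewrite inE /= gpred1.
pose toL (x : G) : set_type [set` L] := insubd (exist _ 1%g L1) x.
have toLE x : x \in L -> set_val (toL x) = x.
  by move=> xL; rewrite set_valE; apply: insubdK; rewrite inE.
have ts t : V (pi t) -> (t / sg (pi t))%g \in L.
  by move=> Vt; apply/rcoset_piE; rewrite sgK.
exists V; split.
  split => //; rewrite /V /= -[b]rcoset_pi_repr -/g rcoset_act_pi.
  by rewrite mulgV.
exists (fun z => set_val z.2 * sg z.1)%g, (fun t => toL (t / sg (pi t))%g); split.
- have oVT : open (V `*` [set: set_type [set` L]]).
    exact: openXT.
  rewrite continuous_open_subspace// => -[x l] /set_mem[/= Vx _].
  apply: (mulg_cvg (u := set_val \o snd) (v := sg \o fst)).
    apply: (@continuous_comp _ _ _ snd set_val); first exact: cvg_snd.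
    exact: initial_continuous.
  by apply: (@continuous_comp _ _ _ fst sg); [exact: cvg_fst|exact: csg].
- have opV : open (pi @^-1` V) by move/continuousP : rcoset_pi_continuous; exact.
  rewrite continuous_open_subspace// => t /set_mem Vt.
  suff : {for t, continuous (set_val \o (fun t => toL (t / sg (pi t))%g))}.
    move=> ct A [B [[C oC <-] BC] BA]; apply: filterS BA _.
    by apply: ct; apply: open_nbhs_nbhs; split.
  have ct : {for t, continuous (fun t => t / sg (pi t))%g}.
    apply: mulg_cvg; first exact: cvg_id.
    apply: invg_cvg; apply: (@continuous_comp _ _ _ pi sg).
      exact: rcoset_pi_continuous.
    exact: csg.
  rewrite /prop_for /continuous_at /= toLE ?ts//; apply: cvg_trans ct.
  apply: near_eq_cvg; have : nbhs t (pi @^-1` V) by apply: open_nbhs_nbhs.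
  by apply: filterS => x Vx /=; rewrite toLE// ts.
- move=> x l Vx /=.
  have lL : set_val l \in L by have := set_valP l.
  have px : pi (set_val l * sg x)%g = x.
    rewrite -[RHS]sgK//; apply/esym/rcoset_piE.
    by rewrite mulgK.
  by split => //; rewrite px mulgK; apply/val_inj; exact: toLE.
- by move=> t Vt /=; rewrite toLE ?ts// mulgVK.
Qed.

End rcoset_fiber_bundle.

Section sup_norm.
Context {R : realType} {T : Type} (A : set T).

Definition sup_norm (f : T -> R) : R := sup [set `|f x| | x in A].

Context (A0 : A !=set0).
Let bounded (f : T -> R) := exists M, forall x, A x -> `|f x| <= M.

Lemma sup_norm_le f M : (forall x, A x -> `|f x| <= M) -> sup_norm f <= M.
Proof.
move=> fM; apply: sup_le_ub; last by move=> _ [x Ax <-]; exact: fM.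
by have [x Ax] := A0; exists `|f x|, x.
Qed.

Lemma le_sup_norm f x : bounded f -> A x -> `|f x| <= sup_norm f.
Proof.
move=> [M fM] Ax; apply: ub_le_sup; last by exists x.
by exists M => _ [y Ay <-]; exact: fM.
Qed.

Lemma sup_normD f g : bounded f -> bounded g ->
  sup_norm (f \+ g) <= sup_norm f + sup_norm g.
Proof.
move=> bf bg; apply: sup_norm_le => x Ax; apply: le_trans (ler_normD _ _) _.
by apply: lerD; exact: le_sup_norm.
Qed.

Lemma sup_normZ (l : R) f : bounded f ->
  sup_norm (fun x => l * f x) = `|l| * sup_norm f.
Proof.
move=> bf; have blf : bounded (fun x => l * f x).
  have [M fM] := bf; exists (`|l| * M) => x Ax.
  by rewrite normrM ler_wpM2l// fM.
apply/eqP; rewrite eq_le; apply/andP; split.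
  by apply: sup_norm_le => x Ax; rewrite normrM ler_wpM2l// le_sup_norm.
have [->|l0] := eqVneq l 0.
  rewrite normr0 mul0r; have [x Ax] := A0.
  by apply: le_trans (le_sup_norm _ Ax); last by exists 0 => *; rewrite mul0r normr0.
rewrite -ler_pdivlMl ?normr_gt0//; apply: sup_norm_le => x Ax.
by rewrite ler_pdivlMl ?normr_gt0// -normrM; apply: (le_sup_norm blf).
Qed.

End sup_norm.

Section dual.
Context {R : realType} (E : normedModType R).

Definition dual_pred : {pred E -> R^o} :=
  fun f => `[< linear f /\ continuous f >].

Lemma dual_pred_submod : submod_closed dual_pred.
Proof.
split=> [|a f g /asboolP[lf cf] /asboolP[lg cg]]; apply/asboolP; split.
- by move=> a u v; rewrite /= scaler0 addr0.
- exact: cst_continuous.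
- by move=> b u v /=; rewrite !fctE lf lg !scalerDr !scalerA (mulrC b) addrACA.
- move=> x; apply: cvgD; last exact: cg.
  by apply: cvgZr; exact: cf.
Qed.

HB.instance Definition _ :=
  GRing.isSubmodClosed.Build R (E -> R^o) dual_pred dual_pred_submod.

Record dual := Dual { dual_fun :> E -> R^o ; dual_funP : dual_fun \in dual_pred }.

HB.instance Definition _ := [isSub for dual_fun].
HB.instance Definition _ := [Choice of dual by <:].
HB.instance Definition _ := [SubChoice_isSubLmodule of dual by <:].

Lemma dual_linear (f : dual) : linear f.
Proof. by have /asboolP[] := dual_funP f. Qed.

Lemma dual_continuous (f : dual) : continuous f.
Proof. by have /asboolP[] := dual_funP f. Qed.

HB.instance Definition _ (f : dual) :=
  GRing.isLinear.Build R E R^o _ (dual_fun f) (dual_linear f).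

Definition dual_norm (f : dual) : R := sup_norm [set x | `|x| <= 1] f.

Let unit_ball0 : [set x : E | `|x| <= 1] !=set0.
Proof. by exists 0; rewrite /= normr0. Qed.

Lemma dual_bounded (f : dual) : exists M, forall x, `|x| <= 1 -> `|f x| <= M.
Proof.
have /linear_bounded_continuous/bounded_funP/(_ 1) := @dual_continuous f.
exact.
Qed.

Lemma dual_normD (f g : dual) : dual_norm (f + g) <= dual_norm f + dual_norm g.
Proof. by apply: sup_normD => //; exact: dual_bounded. Qed.

Lemma dual_normZ (l : R) (f : dual) : dual_norm (l *: f) = `|l| * dual_norm f.
Proof. by apply: sup_normZ => //; exact: dual_bounded. Qed.

Lemma dual_normP (f : dual) x : `|f x| <= dual_norm f * `|x|.
Proof.
have [->|x0] := eqVneq x 0; first by rewrite linear0 !normr0 mulr0.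
have nx0 : 0 < `|x| by rewrite normr_gt0.
have fE : f (`|x|^-1 *: x) = `|x|^-1 * f x by rewrite linearZ.
rewrite mulrC -ler_pdivrMl// -[X in X * _]ger0_norm ?invr_ge0// -normrM -fE.
apply: le_sup_norm; first exact: dual_bounded.
by rewrite /= normrZ ger0_norm ?invr_ge0// mulVf ?gt_eqF.
Qed.

Lemma dual_norm0_eq0 (f : dual) : dual_norm f = 0 -> f = 0.
Proof.
move=> f0; apply/val_inj/funext => x; apply/eqP.
by rewrite -normr_le0 (le_trans (dual_normP f x))// f0 mul0r.
Qed.

HB.instance Definition _ :=
  Lmodule_isNormed.Build R dual dual_normD dual_normZ dual_norm0_eq0.

End dual.

Section bounded_continuous.
Context {R : realType} (G : topologicalGroupType).

Definition CB_pred : {pred G -> R^o} :=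
  fun f => `[< continuous f /\ bounded_fun f >].

Lemma bounded_funE (f : G -> R^o) :
  bounded_fun f <-> exists M, forall x, [set: G] x -> `|f x| <= M.
Proof.
have PF : ProperFilter (globally [set: G]).
  exact: (@globally_properfilter _ _ 1%g).
exact: ex_bound.
Qed.

Lemma CB_pred_submod : submod_closed CB_pred.
Proof.
split=> [|a f g /asboolP[cf bf] /asboolP[cg bg]]; apply/asboolP; split.
- exact: cst_continuous.
- apply/bounded_funE; exists 0 => x _ /=; by rewrite normr0.
- move=> x; apply: cvgD; last exact: cg.
  by apply: cvgZr; exact: cf.
- move/bounded_funE : bf => [M fM]; move/bounded_funE : bg => [N gN].
  apply/bounded_funE; exists (`|a| * M + N) => x _ /=.
  rewrite (le_trans (ler_normD _ _))// lerD//; last exact: gN.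
  by rewrite normrM ler_wpM2l//; exact: fM.
Qed.

HB.instance Definition _ :=
  GRing.isSubmodClosed.Build R (G -> R^o) CB_pred CB_pred_submod.

Record CB := BoundedContinuous
  { CB_fun :> G -> R^o ; CB_funP : CB_fun \in CB_pred }.

HB.instance Definition _ := [isSub for CB_fun].
HB.instance Definition _ := [Choice of CB by <:].
HB.instance Definition _ := [SubChoice_isSubLmodule of CB by <:].

Definition CB_norm (f : CB) : R := sup_norm [set: G] f.

Let G0 : [set: G] !=set0. Proof. by exists 1%g. Qed.

Lemma CB_bounded (f : CB) : exists M, forall x, [set: G] x -> `|f x| <= M.
Proof. by have /asboolP[_ /bounded_funE] := CB_funP f. Qed.

Lemma CB_normD f g : CB_norm (f + g) <= CB_norm f + CB_norm g.
Proof. by apply: sup_normD => //; exact: CB_bounded. Qed.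

Lemma CB_normZ (l : R) f : CB_norm (l *: f) = `|l| * CB_norm f.
Proof. by apply: sup_normZ => //; exact: CB_bounded. Qed.

Lemma CB_norm0_eq0 f : CB_norm f = 0 -> f = 0.
Proof.
move=> f0; apply/val_inj/funext => x; apply/eqP; rewrite -normr_le0 -f0.
by apply: le_sup_norm => //; exact: CB_bounded.
Qed.

HB.instance Definition _ :=
  Lmodule_isNormed.Build R CB CB_normD CB_normZ CB_norm0_eq0.

Lemma CB_one_subproof : (fun=> 1) \in CB_pred.
Proof.
apply/asboolP; split; first exact: cst_continuous.
by apply/bounded_funE; exists 1 => x _ /=; rewrite normr1.
Qed.

Definition CB_one : CB := BoundedContinuous CB_one_subproof.

Lemma CB_ltrans_subproof (y : G) (f : CB) : (fun x => f (y * x)%g) \in CB_pred.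
Proof.
have /asboolP[cf _] := CB_funP f; have [M fM] := CB_bounded f.
apply/asboolP; split; last by apply/bounded_funE; exists M => x _; exact: fM.
move=> x; apply: (@continuous_comp _ _ _ (fun x => y * x)%g); last exact: cf.
apply: (@continuous_comp _ _ _ (fun x => (y, x)) (fun z => z.1 * z.2)%g).
  by apply: cvg_pair => /=; [exact: cvg_cst|exact: cvg_id].
exact: mulg_continuous.
Qed.

Definition CB_ltrans (y : G) (f : CB) : CB :=
  BoundedContinuous (CB_ltrans_subproof y f).

End bounded_continuous.

Arguments CB R G : clear implicits.
Arguments CB_one R G : clear implicits.

Definition left_invariant_mean {R : realType} {G : topologicalGroupType}
    (m : dual (CB R G)) :=
  [/\ m (CB_one R G) = 1, `|m| = 1 & forall f y, m (CB_ltrans y f) = m f].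

Definition strongly_amenable (R : realType) (G : topologicalGroupType) :=
  exists m : dual (CB R G), left_invariant_mean m.

(* Main.v *)
From HB Require Import structures.
Require Import Defs.
From mathcomp Require Import all_boot all_order all_algebra.
From mathcomp Require Import boolp classical_sets functions reals topology.
From mathcomp Require Import normedtype.
Import Order.TTheory GRing.Theory Num.Theory.
Import numFieldNormedType.Exports.
Local Open Scope classical_set_scope.
Local Open Scope ring_scope.

(* Averaging g |-> f(L g y) - f(L g) against a right invariant mean, weakly in
   the dual of E, gives a homomorphism H with |H - h| <= delta.  Being within
   delta of the continuous h, H is bounded near 1, and a locally bounded
   homomorphism into a normed space is continuous.  For l in L one has
   f(L l^n) = f(L), so h, hence H, is bounded on the powers of l and H
   vanishes on L.  Therefore F(L y) := f(L) + H y is well defined, and it is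
   within 2 delta of f(L y). *)

(** * Additive maps from a topological group to a normed space *)

Lemma expg_continuous (G : topologicalGroupType) n :
  continuous (fun x : G => x ^+ n)%g.
Proof.
elim: n => [|n IH] x; first exact: cst_continuous.
have -> : (fun x : G => x ^+ n.+1)%g = (fun x => x * x ^+ n)%g.
  by apply/funext => y; rewrite expgS.
by apply: (mulg_cvg (u := id)); [exact: cvg_id|exact: IH].
Qed.

Section additive_maps.
Context {R : realType} {G : topologicalGroupType} {V : normedModType R}.
Context {H : G -> V}.
Hypothesis HM : forall x y, H (x * y)%g = H x + H y.

Lemma additive1 : H 1%g = 0.
Proof. by apply: (@addrI _ (H 1%g)); rewrite -HM mulg1 addr0. Qed.

Lemma additiveV x : H x^-1%g = - H x.
Proof. by apply/eqP; rewrite -addr_eq0 -HM mulVg additive1. Qed.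

Lemma additiveX x n : H (x ^+ n)%g = H x *+ n.
Proof.
elim: n => [|n IH]; first by rewrite expg0 additive1 mulr0n.
by rewrite expgS HM IH mulrS.
Qed.

(** The norm of [H (x ^+ n)] is [n] times that of [H x], so a bound uniform in [n] contradicts the
    Archimedean property unless [H x] vanishes. *)
Lemma additive_bounded_powers_eq0 x (C : R) :
  (forall n, `|H (x ^+ n)%g| <= C) -> H x = 0.
Proof.
move=> HC; apply/eqP; rewrite -normr_eq0; apply/negP => /negP x0.
have {}x0 : 0 < `|H x| by rewrite lt_def x0 normr_ge0.
have C0 : 0 <= C / `|H x|.
  by rewrite divr_ge0// (le_trans _ (HC 0%N)).
have := archi_boundP C0; rewrite ltr_pdivrMr// mulr_natl -normrMn -additiveX.
by rewrite ltNge HC.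
Qed.

(** Where [y ^+ n] is so close to 1 that the bound [C] applies, [H y] has norm at most [C / n]. This
    gives continuity at 1, and translation carries it to every point. *)
Lemma additive_locally_bounded_continuous (C : R) :
  (\forall x \near (1%g : G), `|H x| <= C) -> continuous H.
Proof.
move=> H1 x; apply/cvgrPdist_le => e e0.
have C0 : 0 <= C by apply: le_trans (nbhs_singleton H1).
(* The successor keeps [n] positive for the divisions below, and [C / e <= n] still holds. *)
set n := (Num.bound (C / e)).+1.
have near1 : \forall y \near (1%g : G), `|H y| <= e.
  have : \forall y \near (1%g : G), `|H (y ^+ n)%g| <= C.
    have := @expg_continuous G n 1%g; rewrite /continuous_at expg1n.
    by move=> cX; exact: (cX _ H1).
  apply: filterS => y /=; rewrite additiveX normrMn -mulr_natl.
  rewrite mulrC -ler_pdivlMr ?ltr0n// => /le_trans; apply.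
  rewrite ler_pdivrMr ?ltr0n// mulrC -ler_pdivrMr//.
  have /ltW/le_trans := archi_boundP (divr_ge0 C0 (ltW e0)); apply.
  by rewrite ler_nat.
have : \forall y \near x, `|H (x / y)%g| <= e.
  have cdiv : {for x, continuous (fun y => x / y)%g}.
    apply: (mulg_cvg (u := cst x)); first exact: cst_continuous.
    exact: invg_continuous.
  move: cdiv; rewrite /prop_for /continuous_at mulgV => cdiv.
  exact: (cdiv _ near1).
by apply: filterS => y /=; rewrite HM additiveV.
Qed.

End additive_maps.

(** * Membership and norm estimates in the dual space *)

Lemma bounded_linear_dual {R : realType} {E : normedModType R}
    (u : E -> R^o) (C : R) :
  linear u -> (forall e, `|u e| <= C * `|e|) -> u \in @dual_pred R E.
Proof.
move=> lu uC; apply/asboolP; split => //.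
pose v : {linear E -> R^o} := HB.pack u (GRing.isLinear.Build R E R^o _ u lu).
apply: (@bounded_linear_continuous _ _ _ v); apply/bounded_funP => r.
(* The sign of [C] is not known, hence the absolute value. *)
exists (`|C| * r) => e er; rewrite (le_trans (uC e))//.
rewrite (le_trans (ler_wpM2r _ (ler_norm C)))//.
by rewrite ler_wpM2l.
Qed.

Section dual_evaluation.
Context {R : realType} {E : normedModType R}.

Lemma dualDE (u v : dual E) e : (u + v) e = u e + v e.
Proof. by []. Qed.

Lemma dualNE (u : dual E) e : (- u) e = - u e.
Proof. by []. Qed.

Lemma dual_norm_le (u : dual E) (C : R) :
  (forall e, `|e| <= 1 -> `|u e| <= C) -> `|u| <= C.
Proof. by move=> uC; apply: sup_norm_le => //; exists 0; rewrite /= normr0. Qed.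

Lemma dual_norm_ge (u : dual E) e : `|u e| <= `|u| * `|e|.
Proof. exact: dual_normP. Qed.

Lemma dual_eval_continuous (e : E) : continuous (fun u : dual E => u e : R^o).
Proof.
have lev : linear (fun u : dual E => u e : R^o) by [].
have /asboolP[_] // : (fun u : dual E => u e : R^o) \in @dual_pred R (dual E).
apply: (bounded_linear_dual _ `|e|) => // u.
by rewrite mulrC dual_norm_ge.
Qed.

End dual_evaluation.

(** * Weak averages of dual-valued functions *)

Lemma CB_norm_le {R : realType} {G : topologicalGroupType} (u : CB R G) (C : R) :
  (forall g, `|u g| <= C) -> `|u| <= C.
Proof. by move=> uC; apply: sup_norm_le => //; exists 1%g. Qed.

(** The weak-* integral of [phi] against [m]. As a relation it needs no proof that the functions
    [phi g e] of [g] are bounded and continuous; each [u] carries its own. *)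
Definition weak_mean {R : realType} {G : topologicalGroupType}
    {E : normedModType R} (m : dual (CB R G)) (phi : G -> dual E)
    (mu : dual E) : Prop :=
  forall e, exists2 u : CB R G, (forall g, u g = phi g e) & mu e = m u.

Section weak_mean.
Context {R : realType} {G : topologicalGroupType} {E : normedModType R}.
Context {m : dual (CB R G)}.

(** For fixed [e] the scalar function [phi g e] of [g] lies in [CB R G]; its mean is linear in [e]
    and bounded by [|m| * C * |e|], so it defines an element of the dual. *)
Lemma weak_mean_exists {phi : G -> dual E} {C : R} :
  continuous phi -> (forall g, `|phi g| <= C) -> exists mu, weak_mean m phi mu.
Proof.
move=> cphi phiC.
have phie g e : `|phi g e| <= C * `|e|.
  by rewrite (le_trans (dual_norm_ge _ _))// ler_wpM2r.
have CBe e : (fun g => phi g e : R^o) \in @CB_pred R G.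
  apply/asboolP; split; last first.
    by apply/bounded_funE; exists (C * `|e|) => g _; exact: phie.
  move=> g; apply: (@continuous_comp _ _ _ phi (fun u : dual E => u e : R^o)).
    exact: cphi.
  exact: dual_eval_continuous.
pose u e := BoundedContinuous (CBe e).
have dmu : (fun e => m (u e)) \in @dual_pred R E.
  apply: (bounded_linear_dual _ (`|m| * C)) => [a e1 e2|e].
    rewrite -linearP; congr (m _); apply/val_inj/funext => g.
    exact: (linearP (phi g)).
  rewrite (le_trans (dual_norm_ge _ _))// -mulrA ler_wpM2l//.
  by apply: CB_norm_le => g; exact: phie.
by exists (Dual dmu) => e; exists (u e).
Qed.

Lemma weak_mean_uniq {phi : G -> dual E} {mu nu : dual E} :
  weak_mean m phi mu -> weak_mean m phi nu -> mu = nu.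
Proof.
move=> pmu pnu; apply/val_inj/funext => e /=.
have [u uE ->] := pmu e; have [v vE ->] := pnu e.
by congr (m _); apply/val_inj/funext => g /=; rewrite uE vE.
Qed.

Lemma weak_meanD {phi psi : G -> dual E} {mu nu : dual E} :
  weak_mean m phi mu -> weak_mean m psi nu ->
  weak_mean m (fun g => phi g + psi g) (mu + nu).
Proof.
move=> pmu pnu e; have [u uE muE] := pmu e; have [v vE nuE] := pnu e.
exists (u + v); last by rewrite dualDE muE nuE linearD.
by move=> g; rewrite dualDE -uE -vE.
Qed.

Lemma weak_mean_ltrans {phi : G -> dual E} {mu : dual E} y :
  left_invariant_mean m -> weak_mean m phi mu ->
  weak_mean m (fun g => phi (y * g)%g) mu.
Proof.
move=> [_ _ mL] pmu e; have [u uE muE] := pmu e.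
by exists (CB_ltrans y u); [move=> g; rewrite -uE|rewrite mL].
Qed.

(** Since [m] sends 1 to 1, [(mu - c) e] is the mean of [(phi g - c) e]; as [m] has norm 1, the
    uniform bound survives averaging. *)
Lemma weak_mean_dist {phi : G -> dual E} {mu c : dual E} {d : R} :
  left_invariant_mean m -> weak_mean m phi mu ->
  (forall g, `|phi g - c| <= d) -> `|mu - c| <= d.
Proof.
move=> [m1 mn _] pmu phid; apply: dual_norm_le => e e1.
have [u uE muE] := pmu e.
have -> : (mu - c) e = m (u - c e *: CB_one R G).
  by rewrite dualDE dualNE muE linearB linearZ /= m1 /GRing.scale /= mulr1.
rewrite (le_trans (dual_norm_ge _ _))// mn mul1r.
apply: CB_norm_le => g.
have -> : (u - c e *: CB_one R G) g = (phi g - c) e.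
  by rewrite dualDE dualNE -uE -[in RHS](mulr1 (c e)).
rewrite (le_trans (dual_norm_ge _ _))//.
by rewrite -[leRHS]mulr1 ler_pM.
Qed.

End weak_mean.

Theorem theorem4p2 (R : realType) (G : topologicalGroupType)
    (L : groupClosed G) (E : completeNormedModType R) (delta : R)
    (h : G -> dual E) (f : rcoset_space L -> dual E) :
  strongly_amenable R G ->
  closed [set` L] ->
  fiber_bundle (rcoset_pi L) ->
  0 <= delta ->
  continuous h ->
  continuous f ->
  (forall x y, `|f (rcoset_act x y) - f x - h y| <= delta) ->
  exists (H : G -> dual E) (F : rcoset_space L -> dual E),
    [/\ continuous H, continuous F
      & forall x y z,
        [/\ H (y * z)%g = H y + H z,
            F (rcoset_act x y) = F x + H y,
            `|H y - h y| <= delta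
          & `|F x - f x| <= 2 * delta]].
Proof.
move=> [m mL] _ _ _ ch cf fh.
pose f' g := f (rcoset_pi L g).
have f'h g y : `|f' (g * y)%g - f' g - h y| <= delta.
  by rewrite /f' -rcoset_act_pi.
have cf' : continuous f'.
  move=> g; apply: (@continuous_comp _ _ _ (rcoset_pi L) f); last exact: cf.
  exact: rcoset_pi_continuous.
(* Inverting [g] turns right translation of the argument of [f'] into left translation of [g], under
   which [m] is invariant. *)
pose phi y g := f' (g^-1 * y)%g - f' g^-1%g.
have cphi y : continuous (phi y).
  move=> g; apply: cvgB.
    apply: (@continuous_comp _ _ _ (fun g => g^-1 * y)%g f'); last exact: cf'.
    by apply: (mulg_cvg (v := cst y)); [exact: invg_continuous|exact: cst_continuous].
  apply: (@continuous_comp _ _ _ (fun g => g^-1)%g f'); last exact: cf'.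
  exact: invg_continuous.
have phiC y g : `|phi y g| <= delta + `|h y|.
  by rewrite -lerBlDr (le_trans (lerB_dist _ _))// f'h.
have /choice[H HE] y : exists mu, weak_mean m (phi y) mu.
  exact: weak_mean_exists (cphi y) (phiC y).
have HM y z : H (y * z)%g = H y + H z.
  apply: (weak_mean_uniq (phi := phi (y * z)%g)) => //; rewrite addrC.
  (* Translating by [y^-1] turns [phi z g] into [f' (g^-1 * y * z) - f' (g^-1 * y)]; adding
     [phi y g] telescopes to [phi (y * z) g]. *)
  have := weak_meanD (weak_mean_ltrans y^-1%g mL (HE z)) (HE y).
  congr weak_mean; apply/funext => g.
  by rewrite /phi invgM invgK mulgA addrA subrK.
have Hh y : `|H y - h y| <= delta.
  by apply: weak_mean_dist mL (HE y) _ => g; exact: f'h.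
have cH : continuous H.
  apply: (additive_locally_bounded_continuous HM
    (delta + (`|h 1%g| + 1))).
  have : \forall y \near (1%g : G), `|h y| <= `|h 1%g| + 1.
    by apply: cvgr_norm_le (ch _) _ _; rewrite ltrDl.
  apply: filterS => y hy; rewrite -[H y](subrK (h y)).
  by rewrite (le_trans (ler_normD _ _))// lerD.
have HL l : l \in L -> H l = 0.
  (* One [delta] is for [H - h], the other for [h (l ^+ n)] itself, because [f'] takes the same
     value at [l ^+ n] and at 1. *)
  move=> lL; apply: (additive_bounded_powers_eq0 HM _ (delta + delta)) => n.
  rewrite -[H _](subrK (h (l ^+ n)%g)) (le_trans (ler_normD _ _))// lerD//.
  have := f'h 1%g (l ^+ n)%g; rewrite mul1g.
  have -> : f' (l ^+ n)%g = f' 1%g.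
    rewrite /f'; congr f; apply/esym/rcoset_piE; rewrite invg1 mulg1.
    elim: n => [|n IH]; first by rewrite expg0 gpred1.
    by rewrite expgS gpredM.
  by rewrite subrr sub0r normrN.
(* The choice of representative is harmless: two of them differ by an element of [L], where [H]
   vanishes. *)
pose F (x : rcoset_space L) := f' 1%g + H (repr x).
have FE g : F (rcoset_pi L g) = f' 1%g + H g.
  rewrite /F; congr (_ + _).
  have /rcoset_piE/HL := rcoset_pi_repr (rcoset_pi L g).
  by rewrite HM additiveV// => /eqP; rewrite subr_eq0 => /eqP.
exists H, F; split => //.
  apply/quotient_continuous.
  rewrite (_ : F \o _ = fun g => f' 1%g + H g); last exact/funext.
  by move=> g; apply: cvgD; [exact: cst_continuous|exact: cH].
move=> x y z; rewrite -[x]rcoset_pi_repr; move: (repr x) => g.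
rewrite rcoset_act_pi !FE !HM addrA; split => //.
(* Both differences have norm at most [delta], the second by the hypothesis on [f] at the base
   coset. *)
rewrite -/(f' g) (_ : _ - _ = (H g - h g) - (f' g - f' 1%g - h g)); last first.
  by rewrite opprB subrKA opprB addrA (addrC (H g)).
rewrite mulr_natl mulr2n (le_trans (ler_normB _ _))// lerD//.
by have := f'h 1%g g; rewrite mul1g.
Qed.
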